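(* Let $(X,\sigma)$ be a minimal shift. Suppose that $(X,\sigma)$ is a somewhere finite-to-one extension of an odometer $(\mathbb Z_{(q_n)},+1)$, i.e. there is a factor map $\pi:(X,\sigma)\to(\mathbb Z_{(q_n)},+1)$ such that $\pi^{-1}(z)$ is finite for some $z\in\mathbb Z_{(q_n)}$. Then the maximal equicontinuous factor of $(X,\sigma)$ is an odometer, which is a rotation on a group extension of $\mathbb Z_{(q_n)}$ by a finite cyclic group $\mathbb Z/h\mathbb Z$ (that is, on a compact group $Z$ admitting a continuous surjective homomorphism $Z\to\mathbb Z_{(q_n)}$ with kernel isomorphic to $\mathbb Z/h\mathbb Z$ for some $h\geq 1$).
   Context: A shift $(X,\sigma)$ is a closed $\sigma$-invariant subset $X\subseteq\mathcal A^{\mathbb Z}$, $\mathcal A$ a finite alphabet, with the left shift $\sigma$. For a sequence $(q_n)_{n\ge0}$ of natural numbers with $q_n\ge 2$ infinitely often, let $p_0=1$, $p_n=q_0\cdots q_{n-1}$ and $\mathbb Z_{(q_n)}=\varprojlim\mathbb Z/p_n\mathbb Z$, a compact metrisable topological group in which $1$ is a topological generator. An odometer is a system $(\mathbb Z_{(q_n)},+1)$. A factor map is a continuous surjection commuting with the dynamics. A system $(Z,S)$ is equicontinuous if $\{S^n:n\in\mathbb Z\}$ is an equicontinuous family; minimal equicontinuous systems are rotations on compact monothetic groups. The maximal equicontinuous factor of $(X,\sigma)$ is the equicontinuous factor through which every other equicontinuous factor of $(X,\sigma)$ factors (unique up to conjugacy). *)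

(* Defs.v *)
From HB Require Import structures.
From mathcomp Require Import all_boot all_order all_algebra.
From mathcomp Require Import all_classical all_reals all_analysis.

Set Implicit Arguments.
Unset Strict Implicit.
Unset Printing Implicit Defensive.

Import GRing.Theory.
Local Open Scope classical_set_scope.
Local Open Scope ring_scope.

(** A system is a space with a self-map; compactness, separation and
    invertibility are required where a notion needs them. *)

Definition factor_map (X Y : topologicalType) (T : X -> X) (S : Y -> Y)
    (f : X -> Y) : Prop :=
  [/\ continuous f, range f = [set: Y] & forall x, f (T x) = S (f x)].

Definition minimal_system (X : topologicalType) (T : X -> X) : Prop :=
  [set: X] !=set0 /\
  forall C : set X, closed C -> T @` C = C -> C = set0 \/ C = [set: X].

(** The power [T ^ n], [n : int], of a bijection [T] with inverse [T']. *)
Definition ziter (X : Type) (T T' : X -> X) (n : int) : X -> X :=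
  match n with Posz m => iter m T | Negz m => iter m.+1 T' end.

(** [equicontinuous] of the library, without its requirement that the space be
    pointed. *)
Definition equicontinuous_family (Z : uniformType) (I : Type) (d : I -> Z -> Z) :
    Prop :=
  forall (x : Z) (E : set (Z * Z)), entourage E ->
    \forall y \near x, forall i, E (d i x, d i y).

(** A compact Hausdorff space carries a unique compatible uniformity, so
    [uniformType] adds no data here; continuity of [S] and of its inverse is part
    of the equicontinuity of the powers. A Hausdorff factor of a compact
    metrisable system is again metrisable. *)
Definition equicontinuous_system (Z : uniformType) (S : Z -> Z) : Prop :=
  [/\ compact [set: Z], hausdorff_space Z &
      exists S' : Z -> Z,
        [/\ cancel S S', cancel S' S & equicontinuous_family (ziter S S')]].

Definition max_equicontinuous_factor (X : topologicalType) (T : X -> X)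
    (Z : uniformType) (S : Z -> Z) (f : X -> Z) : Prop :=
  [/\ equicontinuous_system S, factor_map T S f &
      forall (Y : uniformType) (R : Y -> Y) (g : X -> Y),
        equicontinuous_system R -> factor_map T R g ->
        exists2 h : Z -> Y, factor_map S R h & forall x, g x = h (f x)].

Definition full_shift (A : finType) : Type :=
  prod_topology (fun _ : int => discrete_topology A).

HB.instance Definition _ (A : finType) :=
  Uniform.copy (full_shift A)
    (prod_topology (fun _ : int => discrete_topology A)).

Definition shift (A : finType) (x : full_shift A) : full_shift A :=
  fun i => x (i + 1).

Definition is_shift (A : finType) (X : set (full_shift A)) : Prop :=
  closed X /\ @shift A @` X = X.

Lemma is_shift_stable (A : finType) (X : set (full_shift A)) :
  is_shift X -> forall x : X, shift (\val x) \in X.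
Proof.
move=> [_ hX] x; apply/mem_set.
have : (@shift A @` X) (shift (\val x)) by exists (\val x) => //; exact: set_valP.
by rewrite {1}hX.
Qed.

Definition shift_on (A : finType) (X : set (full_shift A)) (hX : is_shift X) :
    X -> X :=
  fun x => exist _ (shift (\val x)) (is_shift_stable hX x).

(** The [q n] are positive, so that every [Z / p_n Z] is finite. *)
Record odoseq := OdoSeq {
  odoq :> nat -> nat;
  odoq_gt0 : forall n, (0 < odoq n)%N;
  odoq_inf : forall N, exists2 n, (N <= n)%N & (1 < odoq n)%N }.

Definition odop (q : odoseq) (n : nat) : nat := (\prod_(i < n) q i)%N.

Lemma odop_gt0 (q : odoseq) n : (0 < odop q n)%N.
Proof. by rewrite prodn_gt0 // => i; exact: odoq_gt0. Qed.

Lemma odopK (q : odoseq) n : (odop q n).-1.+1 = odop q n.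
Proof. exact/prednK/odop_gt0. Qed.

Lemma odop_dvdS (q : odoseq) n : (odop q n %| odop q n.+1)%N.
Proof. by rewrite /odop big_ord_recr dvdn_mulr. Qed.

(** [Z / p_n Z]: [(odop q n).-1.+1] is [odop q n], by [odopK], in the form on
    which ['I_m.+1] carries its group structure (also for [m = 0]). *)
Notation odocyc q n := 'I_(odop q n).-1.+1.

Definition odoprod (q : odoseq) : Type :=
  prod_topology (fun n => discrete_topology (odocyc q n)).

HB.instance Definition _ (q : odoseq) :=
  Uniform.copy (odoprod q)
    (prod_topology (fun n => discrete_topology (odocyc q n))).

Definition odocoord (q : odoseq) (x : odoprod q) (n : nat) : odocyc q n := x n.

(** The threads of the inverse system [Z / p_n.+1 Z -> Z / p_n Z]. *)
Definition odolim (q : odoseq) : set (odoprod q) :=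
  [set x | forall n, (odocoord x n.+1 %% odop q n)%N = odocoord x n].
Arguments odolim : clear implicits.

Definition odometer (q : odoseq) : Type := set_type (odolim q).

HB.instance Definition _ (q : odoseq) :=
  Uniform.copy (odometer q) (set_type (odolim q)).

Section OdometerGroup.
Variable q : odoseq.
Implicit Types x y z : odometer q.

Definition odoval x n : odocyc q n := odocoord (\val x) n.

Lemma odovalS x n : (odoval x n.+1 %% odop q n)%N = odoval x n.
Proof. by have := set_valP x; apply. Qed.

Lemma odoval_inj x y : (forall n, odoval x n = odoval y n) -> x = y.
Proof. by move=> e; apply/val_inj/functional_extensionality_dep. Qed.

Lemma odomk_subproof (f : forall n, odocyc q n) :
  (forall n, (f n.+1 %% odop q n)%N = f n) -> (f : odoprod q) \in odolim q.
Proof. by move=> hf; apply/mem_set. Qed.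

Definition odomk (f : forall n, odocyc q n)
    (hf : forall n, (f n.+1 %% odop q n)%N = f n) : odometer q :=
  exist _ (f : odoprod q) (odomk_subproof hf).

Lemma odozero_subproof n : ((0%R : odocyc q n.+1) %% odop q n)%N = (0%R : odocyc q n).
Proof. by rewrite mod0n. Qed.

Lemma odocycD n (a b : odocyc q n) : (a + b)%R = ((a + b) %% odop q n)%N :> nat.
Proof. by rewrite /=; move: (a : nat) (b : nat) => k l; rewrite odopK. Qed.

Lemma odocycN n (a : odocyc q n) : (- a)%R = ((odop q n - a) %% odop q n)%N :> nat.
Proof. by rewrite /=; move: (a : nat) => k; rewrite odopK. Qed.

Lemma odoopp_subproof x n :
  ((- odoval x n.+1)%R %% odop q n)%N = (- odoval x n)%R.
Proof.
rewrite !odocycN -(odovalS x n) modn_dvdm ?odop_dvdS //.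
have : (odoval x n.+1 <= odop q n.+1)%N by rewrite -[leqRHS]odopK ltnW.
move: (odoval x n.+1 : nat) => k hk.
apply/eqP; rewrite -(eqn_modDr k) subnK // -modnDmr subnK.
  by rewrite (eqP (odop_dvdS q n)) modnn.
by rewrite ltnW // ltn_pmod // odop_gt0.
Qed.

Lemma odoadd_subproof x y n :
  ((odoval x n.+1 + odoval y n.+1)%R %% odop q n)%N = (odoval x n + odoval y n)%R.
Proof. by rewrite !odocycD -!(odovalS _ n) modn_dvdm ?odop_dvdS // modnDm. Qed.

Lemma odoone_subproof n :
  ((inZp 1 : odocyc q n.+1) %% odop q n)%N = (inZp 1 : odocyc q n).
Proof. by rewrite /= !odopK modn_dvdm ?odop_dvdS. Qed.

Definition odozero : odometer q := odomk odozero_subproof.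
Definition odoopp x : odometer q := odomk (odoopp_subproof x).
Definition odoadd x y : odometer q := odomk (odoadd_subproof x y).

Definition odoone : odometer q := odomk odoone_subproof.

Let odoaddA : associative odoadd.
Proof. by move=> x y z; apply: odoval_inj => n; exact: addrA. Qed.

Let odoaddC : commutative odoadd.
Proof. by move=> x y; apply: odoval_inj => n; exact: addrC. Qed.

Let odoadd0 : left_id odozero odoadd.
Proof. by move=> x; apply: odoval_inj => n; exact: add0r. Qed.

Let odoaddN : left_inverse odozero odoopp odoadd.
Proof. by move=> x; apply: odoval_inj => n; exact: addNr. Qed.

HB.instance Definition _ :=
  GRing.isZmodule.Build (odometer q) odoaddA odoaddC odoadd0 odoaddN.

Lemma odoval_near x n : \forall y \near x, odoval y n = odoval x n.
Proof.
pose K k : topologicalType := discrete_topology (odocyc q k).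
have c : continuous ((@proj _ K n) \o (@set_val _ (odolim q))).
  move=> y; apply: continuous_comp; last exact: proj_continuous.
  exact: initial_continuous.
apply: (c x [set u | u = odoval x n]).
exact/principal_filterP.
Qed.

Lemma odosub_continuous :
  continuous (fun x : odometer q * odometer q => x.1 - x.2).
Proof.
apply: continuous_comp_initial => x; apply/cvg_sup => n.
pose K k : topologicalType := discrete_topology (odocyc q k).
move: x; apply: (@continuous_comp_initial _ _ (K n) (@proj _ K n)) => x A.
move=> /(_ _ erefl) Ax.
exists ([set y | odoval y n = odoval x.1 n], [set y | odoval y n = odoval x.2 n]).
  by split; exact: odoval_near.
move=> [y z] /= [ey ez].
suff -> : proj n (\val (y - z)) = proj n (\val (x.1 - x.2)) by [].
by rewrite -[LHS]/(odoval y n - odoval z n) ey ez.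
Qed.

HB.instance Definition _ :=
  PreTopologicalNmodule_isTopologicalZmodule.Build (odometer q) odosub_continuous.

End OdometerGroup.

Definition odostep (q : odoseq) (x : odometer q) : odometer q := x + odoone q.

(** [phi] presents [Z] as an extension of [Z'] by a finite cyclic group: it is a
    continuous surjective homomorphism, and [i] identifies its kernel with
    [Z / h Z], [h = k.+1]. *)
Definition finite_cyclic_extension (Z Z' : topologicalZmodType)
    (phi : {additive Z -> Z'}) : Prop :=
  [/\ continuous phi, range phi = [set: Z'] &
      exists (k : nat) (i : {additive 'I_k.+1 -> Z}),
        injective i /\ range i = [set z | phi z = 0]].

(* Main.v *)
Require Import Defs.
From HB Require Import structures.
From mathcomp Require Import all_boot all_order all_algebra.
From mathcomp Require Import all_classical all_reals all_analysis.
From mathcomp Require Import zify.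

(** Call [d] a period of [X] if [X] factors onto [Z / d Z]; periods are closed
    under lcm, and every [p_n] is one. If [h * p_n] is a period and [h] is
    coprime to [q_m] for all [m >= n], then every fibre of [p] meets at least
    [h] classes modulo [h * p_n], so [h] is bounded by the size of the finite
    fibre. For [h] maximal, every period divides some [h * p_m], and the
    odometer of the numbers [h * p_m] is a factor of [X] whose projection to
    [Z_(q_n)] has kernel [Z / h Z].

    It is the maximal equicontinuous factor because, over a small cylinder
    around the point with finite fibre, being close under all powers of an
    equicontinuous factor is an equivalence relation. Its classes are clopen
    blocks for the shift, so they are cut out by a period; hence points with
    the same image in the odometer are arbitrarily close in the equicontinuous
    factor. *)

Set Implicit Arguments.
Unset Strict Implicit.
Unset Printing Implicit Defensive.

Local Open Scope classical_set_scope.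
Import GRing.Theory.

(** * Locally constant maps and compactness *)

Definition locally_constant (X : topologicalType) (B : Type) (F : X -> B) :
    Prop :=
  forall x, \forall y \near x, F y = F x.

Section Topology.
Variable X : topologicalType.

Lemma locally_constant_comp (B C : Type) (F : X -> B) (h : B -> C) :
  locally_constant F -> locally_constant (fun x => h (F x)).
Proof. by move=> lF x; apply: filterS (lF x) => y ->. Qed.

Lemma locally_constant_continuous (Y : topologicalType) (B : Type) (F : Y -> B)
    (g : X -> Y) :
  continuous g -> locally_constant F -> locally_constant (fun x => F (g x)).
Proof. by move=> cg lF x; exact: (cg x _ (lF (g x))). Qed.

Lemma locally_constant_closed (U : set X) : locally_constant U -> closed U.
Proof.
by move=> lU x clx; have [y [Uy <-]] := clx _ (lU x).
Qed.

Lemma prod_topology_continuous (W : topologicalType) (I : eqType)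
    (K : I -> topologicalType) (F : W -> prod_topology K) :
  (forall i, continuous (fun w => F w i)) -> continuous F.
Proof.
move=> cF w; apply/cvg_sup => i; move: w.
apply: (@continuous_comp_initial _ _ (K i) (@proj _ K i)).
exact: cF.
Qed.

Lemma nested_compact (K : nat -> set X) :
  compact [set: X] -> (forall n, closed (K n)) -> (forall n, K n !=set0) ->
  (forall n, K n.+1 `<=` K n) -> exists x, forall n, K n x.
Proof.
move=> cX clK K0 Kd.
have Kle m n : (m <= n)%N -> K n `<=` K m.
  move=> /subnK <-; elim: (n - m)%N => [//|k IH]; rewrite addSn.
  exact: subset_trans (Kd _) IH.
have FF : ProperFilter (filter_from [set: nat] K).
  apply: filter_from_proper; last by move=> i _; exact: K0.
  apply: filter_from_filter; first by exists 0%N.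
  move=> i j _ _; exists (maxn i j) => // x Kx.
  by split; apply: Kle Kx; rewrite ?leq_maxl ?leq_maxr.
have [|x [_ clx]] := cX (filter_from [set: nat] K) FF.
  by exists 0%N => // x.
exists x => n; apply: clK => B Bx.
by apply: clx => //; exists n.
Qed.

End Topology.

(** * Clocks and clopen blocks of a minimal system *)

Section Minimal.
Variables (X : topologicalType) (T : X -> X).
Hypotheses (cX : compact [set: X]) (hX : hausdorff_space X).
Hypotheses (cT : continuous T) (injT : injective T) (mT : minimal_system T).

Lemma continuous_iter n : continuous (iter n T).
Proof.
elim: n => [|n IH] x; first exact: cvg_id.
exact: (continuous_comp (IH x) (@cT (iter n T x))).
Qed.

(** Minimality concerns sets equal to their own image. The intersection of the iterated images of
    [C] is one, nonempty by compactness. The lemma serves as induction along an orbit for closed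
    conditions. *)
Lemma minimal_forward (C : set X) x0 :
  closed C -> C x0 -> (forall x, C x -> C (T x)) -> forall x, C x.
Proof.
move=> clC C0 CT.
pose K j := iter j T @` C.
have Kd n : K n.+1 `<=` K n.
  by move=> _ [x Cx <-]; exists (T x); [exact: CT|rewrite -iterSr].
have [|n||z Kz] := @nested_compact X K cX.
- move=> n; apply: compact_closed => //; apply: continuous_compact.
    exact/continuous_subspaceT/continuous_iter.
  exact: subclosed_compact clC cX _.
- by exists (iter n T x0), x0.
- by [].
have [] := mT.2 (\bigcap_n K n).
- apply: closed_bigI => n _.
  apply: compact_closed => //; apply: continuous_compact.
    exact/continuous_subspaceT/continuous_iter.
  exact: subclosed_compact clC cX _.
- rewrite eqEsubset; split=> [_ [x Kx <-] n _|x Kx].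
    by apply: Kd; have [y Cy <-] := Kx n I; exists y.
  (* By injectivity, the single preimage [y] of [x] lies in every [K n]. *)
  have [y _ yx] := Kx 1%N I; exists y => // n _.
  have [w Cw] := Kx n.+1 I; rewrite -yx /= => /injT <-; by exists w.
- by move=> K0; have : (\bigcap_n K n) z by []; rewrite K0.
- move=> KT x; have : (\bigcap_n K n) x by rewrite KT.
  by move=> /(_ 0%N I) [y Cy <-].
Qed.

(* [c] stands for a factor map to [Z / d Z]: only values modulo [d] count. *)
Definition clock (d : nat) (c : X -> nat) : Prop :=
  locally_constant (fun x => c x %% d)%N /\
  forall x, c (T x) = (c x).+1 %[mod d].

Definition period (d : nat) : Prop := (0 < d)%N /\ exists c, clock d c.

Lemma period1 : period 1.
Proof. by split=> //; exists (fun=> 0%N); split=> // x; near=> y.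
Unshelve. all: by end_near. Qed.

Lemma clock_iter d c n x : clock d c -> c (iter n T x) = (c x + n)%N %[mod d].
Proof.
move=> [_ cc]; elim: n => [|n IH]; first by rewrite addn0.
by rewrite iterS cc -addn1 -modnDml IH modnDml addn1 addnS.
Qed.

(** The difference [c' - c] modulo [d] is invariant and locally constant, hence constant. Sums are
    compared, to avoid truncated subtraction. *)
Lemma clock_unique d c c' x y : clock d c -> clock d c' ->
  c x = c y %[mod d] -> c' x = c' y %[mod d].
Proof.
move=> [lc cc] [lc' cc'] cxy.
pose C := [set w | c' w + c x = c' x + c w %[mod d]].
have : C y.
  apply: (@minimal_forward _ x) => //.
  - apply: locally_constant_closed => w.
    apply: filterS2 (lc w) (lc' w) => v e e'.
    by rewrite /C /= -(modnDml (c' v)) -(modnDmr _ (c v)) e e' modnDml modnDmr.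
  - rewrite /C => w /= e; rewrite -(modnDml (c' (T w))) -(modnDmr _ (c (T w))).
    rewrite cc cc'.
    by rewrite modnDml modnDmr addSn addnS -!(addn1 (_ + _)) -modnDml e modnDml.
rewrite /C /= -(modnDmr _ (c y)) -cxy modnDmr => /eqP.
by rewrite eqn_modDr => /eqP.
Qed.

Lemma clock_dvd d d' c : (d' %| d)%N -> clock d c -> clock d' c.
Proof.
move=> dd [lc cc]; split.
  move=> x; apply: filterS (lc x) => y e.
  by rewrite -(modn_dvdm (c y) dd) e modn_dvdm.
by move=> x; rewrite -(modn_dvdm _ dd) cc modn_dvdm.
Qed.

(** Points whose forward orbit avoids [U] form a closed forward-invariant set missing [u], hence an
    empty one. *)
Lemma minimal_hit (U : set X) u x : locally_constant U -> U u ->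
  exists t, U (iter t T x).
Proof.
move=> lU Uu; apply: contrapT => nU.
pose C := [set w | forall t, ~ U (iter t T w)].
suff /(_ u 0%N) : forall w, C w by [].
apply: (@minimal_forward _ x).
- have -> : C = \bigcap_t [set w | ~ U (iter t T w)].
    rewrite eqEsubset; split=> [w Cw t _|w Cw t]; first exact: Cw.
    exact: (Cw t I).
  apply: closed_bigI => t _; apply: locally_constant_closed.
  have := locally_constant_comp not
    (locally_constant_continuous (@continuous_iter t) lU).
  exact.
- by move=> t Ut; apply: nU; exists t.
- by move=> w Cw t; rewrite -iterSr; exact: Cw.
Qed.

(** The last hypothesis makes [U] a clopen block: all its points have the same return times. These
    are the multiples of the least positive one, [d], and the clock is minus the time of first entry
    into [U]. *)
Lemma block_clock (U : set X) u : locally_constant U -> U u ->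
  (forall m a b, U a -> U b -> U (iter m T a) -> U (iter m T b)) ->
  exists d, exists c, [/\ (0 < d)%N, clock d c,
    forall m, U (iter m T u) <-> (d %| m)%N &
    forall x y, c x = c y %[mod d] ->
      exists t, U (iter t T x) /\ U (iter t T y)].
Proof.
move=> lU Uu Uret.
have hit x : exists t, `[< U (iter t T x) >].
  by have [t Ut] := minimal_hit x lU Uu; exists t; apply/asboolP.
have ret : exists t, (0 < t)%N && `[< U (iter t T u) >].
  have [t Ut] := minimal_hit (T u) lU Uu.
  by exists t.+1; apply/andP; split=> //; apply/asboolP; rewrite iterSr.
have [d /andP[d0 /asboolP Ud] dmin] := ex_minnP ret.
have Umul k x : U x -> U (iter (k * d) T x).
  move=> Ux; elim: k => [//|k IH]; rewrite mulSn iterD.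
  exact: Uret Uu IH Ud.
have Udvd m : U (iter m T u) <-> (d %| m)%N.
  split=> [Um|/dvdnP[k ->]]; last exact: Umul.
  apply: contrapT => /negP nd.
  have r0 : (0 < m %% d)%N by rewrite lt0n.
  have : (d <= m %% d)%N.
    apply: dmin; rewrite r0; apply/asboolP.
    apply: (Uret _ _ _ (Umul (m %/ d)%N _ Uu) Uu).
    by rewrite -iterD addnC -divn_eq.
  by rewrite leqNgt ltn_pmod.
pose h x := ex_minn (hit x).
have hP x : U (iter (h x) T x).
  by rewrite /h; case: ex_minnP => m /asboolP.
have hle x m : U (iter m T x) -> (h x <= m)%N.
  by rewrite /h; case: ex_minnP => k _ km Um; apply/km/asboolP.
(* The entry time is decided by which of the iterates up to time [h x] lie in [U], and this is
   locally constant. *)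
have lh : locally_constant h.
  move=> x.
  have near_ : forall n, \forall y \near x, forall t, (t < n)%N ->
      U (iter t T y) = U (iter t T x).
    elim=> [|n IH]; first by near=> y.
    have := locally_constant_continuous (@continuous_iter n) lU x.
    apply: filterS2 IH => y IH e t; rewrite ltnS leq_eqVlt => /orP[/eqP -> //|].
    exact: IH.
  apply: filterS (near_ (h x).+1) => y hy.
  have hyx : (h y <= h x)%N by apply: hle; rewrite hy.
  by apply/anti_leq; rewrite hyx /= hle // -hy.
(* Outside [U] the entry time drops by one; from a point [x] of [U], [(h (T x)).+1] is a return
   time. *)
have hT x : (h (T x)).+1 = h x %[mod d].
  case: (boolP (h x == 0%N)) => [/eqP e|].
    have Ux : U x by have := hP x; rewrite e.
    rewrite e mod0n; apply/eqP/Udvd.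
    by apply: (Uret _ _ _ Ux Uu); rewrite iterSr.
  rewrite -lt0n => h0; congr (_ %% _)%N; rewrite -(prednK h0); congr _.+1.
  apply/anti_leq/andP; split.
    by apply: hle; rewrite -iterSr prednK.
  by rewrite -ltnS prednK //; apply: hle; rewrite iterSr.
(* [h] decreases along orbits; [d.-1 * h] is congruent to [- h]. *)
exists d, (fun x => d.-1 * h x)%N; split => //.
- split; first exact: (locally_constant_comp (fun k => (d.-1 * k) %% d)%N lh).
  move=> x.
  apply/eqP; rewrite -(eqn_modDr d.-1) addSnnS prednK // modnDr.
  by rewrite -mulnSr -modnMmr hT modnMmr.
(* Multiplication by [d.-1] is an involution modulo [d], so equal clocks give congruent entry times.
   The point entering first is back in [U] when the other one enters. *)
- have dd k : d.-1 * (d.-1 * k) = k %[mod d].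
    apply/eqP; rewrite -(eqn_modDr (d.-1 * k)) -mulSnr -mulSn prednK //.
    by rewrite !modnMr.
  suff side x y : (h x <= h y)%N -> h x = h y %[mod d] -> U (iter (h y) T x).
    move=> x y exy; have e : h x = h y %[mod d].
      by rewrite -dd -modnMmr exy modnMmr dd.
    case/orP: (leq_total (h x) (h y)) => xy.
      by exists (h y); split=> //; exact: side.
    by exists (h x); split=> //; exact: side.
  move=> xy /esym/eqP; rewrite eqn_mod_dvd // => /dvdnP[k e].
  by rewrite -(subnK xy) e iterD; exact: Umul.
Unshelve. all: by end_near. Qed.

End Minimal.

(** * Arithmetic of the partial products and coordinates of an odometer *)

Section Odoseq.
Variable q : odoseq.

Lemma odopS n : odop q n.+1 = (odop q n * q n)%N.
Proof. by rewrite /odop big_ord_recr. Qed.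

Lemma odop_dvd m n : (m <= n)%N -> (odop q m %| odop q n)%N.
Proof.
move=> /subnK <-; elim: (n - m)%N => [//|k IH].
exact: dvdn_trans IH (odop_dvdS q _).
Qed.

Lemma odop_coprime h n m : (n <= m)%N ->
  (forall k, (n <= k)%N -> coprime h (q k)) ->
  exists2 r, odop q m = (r * odop q n)%N & coprime h r.
Proof.
move=> /subnK <- co; elim: (m - n)%N => [|k [r e cr]].
  by exists 1%N; rewrite ?mul1n ?coprimen1.
exists (r * q (k + n))%N; first by rewrite addSn odopS e mulnAC.
by rewrite coprimeMr cr co // leq_addl.
Qed.

(** Take [n] with [gcdn d (odop q n)] maximal and let [h] be [d] divided by this gcd: a common
    factor of [h] and a later [q m] would enlarge the gcd. *)
Lemma lcm_odop d n0 : (0 < d)%N ->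
  exists n h, [/\ (n0 <= n)%N, lcmn d (odop q n) = (h * odop q n)%N &
    forall m, (n <= m)%N -> coprime h (q m)].
Proof.
move=> d0; pose P g := `[< exists2 n, (n0 <= n)%N & g = gcdn d (odop q n) >].
have exP : exists g, P g.
  by exists (gcdn d (odop q n0)); apply/asboolP; exists n0.
have [|g /asboolP[n n0n eg] gmax] := @ex_maxnP P d exP.
  by move=> g /asboolP[n _ ->]; rewrite dvdn_leq // dvdn_gcdl.
have g0 : (0 < g)%N by rewrite eg gcdn_gt0 d0.
have gd : (g %| d)%N by rewrite eg dvdn_gcdl.
exists n, (d %/ g)%N; split=> // [|m nm].
  apply/eqP; rewrite -(eqn_pmul2r g0) mulnAC divnK // [X in (_ * X)%N]eg.
  by rewrite muln_lcm_gcd.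
set e := gcdn (d %/ g)%N (q m).
have egm : (e * g)%N %| gcdn d (odop q m.+1).
  rewrite dvdn_gcd -{1}(divnK gd) dvdn_mul ?dvdn_gcdl //= odopS mulnC.
  rewrite dvdn_mul ?dvdn_gcdr //.
  by apply: dvdn_trans _ (odop_dvd nm); rewrite eg dvdn_gcdr.
have : (gcdn d (odop q m.+1) <= g)%N.
  by apply: gmax; apply/asboolP; exists m.+1 => //; lia.
move=> /(leq_trans (dvdn_leq _ egm)); rewrite gcdn_gt0 d0 -{2}(mul1n g).
move=> /(_ isT).
rewrite leq_pmul2r // => e1; rewrite /coprime eqn_leq e1 /=.
by rewrite gcdn_gt0 odoq_gt0 orbT.
Qed.

Lemma odoval_step (z : odometer q) n :
  odoval (odostep z) n = (odoval z n).+1 %[mod odop q n].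
Proof.
rewrite /odostep [odoval _ n](_ : _ = (odoval z n + odoval (odoone q) n)%R) //.
rewrite odocycD modn_mod.
have -> : (odoval (odoone q) n : nat) = (1 %% odop q n)%N.
  by rewrite [odoval _ n](_ : _ = inZp 1) //= odopK.
by rewrite modnDmr addn1.
Qed.

Lemma odoval_mod (z : odometer q) m n : (m <= n)%N ->
  (odoval z n %% odop q m)%N = odoval z m.
Proof.
move=> /subnK <-; elim: (n - m)%N => [|k IH].
  by rewrite modn_small // -[X in (_ < X)%N]odopK.
rewrite -IH -(odovalS z (k + m)) modn_dvdm //; apply: odop_dvd; exact: leq_addl.
Qed.

Lemma odoval_eqP (z w : odometer q) n :
  odoval z n = odoval w n %[mod odop q n] <-> odoval z n = odoval w n.
Proof.
split=> [e|-> //]; apply/val_inj.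
by rewrite /= -(odoval_mod z (leqnn n)) -(odoval_mod w (leqnn n)).
Qed.

Lemma odoval_locally_constant n :
  locally_constant (fun z : odometer q => odoval z n).
Proof. by move=> z; exact: odoval_near. Qed.

End Odoseq.

(** * Periods of an extension of an odometer *)

Section Periods.
Variables (X : topologicalType) (T : X -> X).
Hypotheses (cX : compact [set: X]) (hX : hausdorff_space X).
Hypotheses (cT : continuous T) (injT : injective T) (mT : minimal_system T).

Let x0 : X := sval (cid mT.1).

(** The points showing the same two clock values as [x0] form a block whose return times are the
    common multiples of [d] and [e]. *)
Lemma period_lcm d e : period T d -> period T e -> period T (lcmn d e).
Proof.
move=> [d0 [c cc]] [e0 [b cb]].
pose U := [set x | c x = c x0 %[mod d] /\ b x = b x0 %[mod e]].
have UE m x : U x -> U (iter m T x) <-> (lcmn d e %| m)%N.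
  move=> [cx bx]; rewrite /U /= !(clock_iter m x cc, clock_iter m x cb).
  rewrite -(modnDml (c x)) cx modnDml -(modnDml (b x)) bx modnDml dvdn_lcm.
  rewrite -{2}(addn0 (c x0)) -{2}(addn0 (b x0)).
  split=> [[/eqP + /eqP]|/andP[dm em]].
    by rewrite !eqn_modDl !mod0n => dm em; apply/andP.
  by split; apply/eqP; rewrite eqn_modDl mod0n.
have lU : locally_constant U.
  move=> x; apply: filterS2 (cc.1 x) (cb.1 x) => y ec eb.
  by rewrite /U /= ec eb.
have [|m a b' Ua Ub|l [k [l0 ck lP _]]] :=
    block_clock cX hX cT injT mT (u := x0) lU.
- by [].
- by move=> /(UE _ _ Ua) ?; apply/(UE _ _ Ub).
split; first by rewrite lcmn_gt0 d0.
have <- : l = lcmn d e; last by exists k.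
by apply/eqP; rewrite eqn_dvd; apply/andP; split;
  [apply/lP/UE | apply/(UE _ x0)/lP].
Qed.

Variables (q : odoseq) (p : X -> odometer q).
Hypothesis fp : factor_map T (@odostep q) p.

Lemma clock_odoval (q' : odoseq) (F : X -> odometer q') n : continuous F ->
  (forall x, F (T x) = odostep (F x)) ->
  clock T (odop q' n) (fun x => odoval (F x) n).
Proof.
move=> cF FT; split=> [|x]; last by rewrite FT odoval_step.
have lo := @odoval_locally_constant q' n.
exact: (locally_constant_comp (fun i : 'I_(odop q' n).-1.+1 => i %% odop q' n)%N
  (locally_constant_continuous cF lo)).
Qed.

Let cp n : clock T (odop q n) (fun x => odoval (p x) n).
Proof. by case: fp => cp _ pT; exact: clock_odoval. Qed.

(** Coprimality keeps [h] from being absorbed by the odometer: for [m >= n] the lcm of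
    [h * odop q n] and [odop q m] is [h * odop q m]. *)
Definition coprime_period (h n : nat) : Prop :=
  period T (h * odop q n) /\ forall m, (n <= m)%N -> coprime h (q m).

Lemma coprime_period_gt0 h n : coprime_period h n -> (0 < h)%N.
Proof. by move=> [[+ _] _]; rewrite muln_gt0 => /andP[]. Qed.

Lemma coprime_period_le h n m :
  (n <= m)%N -> coprime_period h n -> coprime_period h m.
Proof.
move=> nm [ph co]; split=> [|k mk]; last by apply: co; lia.
have [r e cr] := @odop_coprime q h n m nm co.
have -> : (h * odop q m)%N = lcmn (h * odop q n) (odop q m).
  rewrite e -muln_lcml mulnA; congr (_ * _)%N; apply/eqP.
  by rewrite -(muln_lcm_gcd h r) (eqP cr) muln1.
apply: period_lcm => //; split; first exact: odop_gt0.
by exists (fun x => odoval (p x) m).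
Qed.

(* The point [x] is a limit of points [T ^ t x1] with [t] a multiple of
   [odop q m], [m] large, and [t = j * odop q n] modulo [h * odop q n]. *)
Lemma coprime_period_fibre h n c x1 j :
  coprime_period h n -> clock T (h * odop q n) c ->
  exists2 x, p x = p x1 & c x = (c x1 + j * odop q n)%N %[mod h * odop q n].
Proof.
move=> gh cc; pose K m := [set x |
  odoval (p x) (n + m) = odoval (p x1) (n + m) /\
  c x = (c x1 + j * odop q n)%N %[mod h * odop q n]].
have [|m|m x [e1 e2]|x Kx] := @nested_compact X K cX.
- move=> m; apply: locally_constant_closed => x.
  have lo := @odoval_locally_constant q (n + m).
  case: fp => ctp _ _; have := locally_constant_continuous ctp lo x.
  by apply: filterS2 (cc.1 x) => y ec eo; rewrite /K /= ec eo.
- have [r e cr] := @odop_coprime q h n (n + m)%N (leq_addr _ _) gh.2.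
  (* As [r] divides [s], the time [s * odop q n] is a multiple of [odop q (n + m)]; as [s] is [j]
     modulo [h], it moves the clock by [j * odop q n]. *)
  pose s := chinese h r j 0; exists (iter (s * odop q n) T x1).
  have rs : (r %| s)%N by rewrite /dvdn chinese_modr ?mod0n.
  have sj : s = j %[mod h] by exact: chinese_modl.
  split.
    apply/odoval_eqP; rewrite (clock_iter _ _ (cp _)) -modnDmr.
    suff /eqP -> : (odop q (n + m) %| s * odop q n)%N by rewrite addn0.
    by rewrite e dvdn_mul.
  rewrite (clock_iter _ _ cc) -modnDmr -muln_modl sj muln_modl.
  by rewrite modnDmr.
- split=> //; apply/val_inj => /=.
  rewrite -(odoval_mod (p x) (n := (n + m).+1)) //.
  rewrite -(odoval_mod (p x1) (n := (n + m).+1)) //.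
  by rewrite -addnS e1.
exists x; last by case: (Kx 0%N).
apply: odoval_inj => m; apply/val_inj => /=.
rewrite -(odoval_mod (p x) (n := (n + m))) ?leq_addl //.
by rewrite -(odoval_mod (p x1) (n := (n + m))) ?leq_addl // (Kx m).1.
Qed.

(** The fibre contains a point for each [j < h], and their clock values are distinct modulo
    [h * odop q n]. *)
Lemma coprime_period_bound h n z (s : seq X) :
  (forall x, p x = z -> x \in s) -> coprime_period h n -> (h <= size s)%N.
Proof.
move=> zs gh; have [_ [c cc]] := gh.1.
have [x1 _ px1] : range p z by case: fp => _ -> _.
have ex (j : 'I_h) : exists x, p x = z /\
    c x = (c x1 + j * odop q n)%N %[mod h * odop q n].
  by have [x px cx] := coprime_period_fibre x1 j gh cc; exists x; rewrite px.
pose g (j : 'I_h) := sval (cid (ex j)).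
have gP j : p (g j) = z /\
    c (g j) = (c x1 + j * odop q n)%N %[mod h * odop q n].
  exact: svalP (cid (ex j)).
rewrite -(size_enum_ord h) -(size_map g); apply: uniq_leq_size.
  rewrite map_inj_uniq ?enum_uniq // => i j e.
  have := (gP i).2; rewrite e (gP j).2 => /eqP; rewrite eqn_modDl => /eqP.
  rewrite -!muln_modl => /eqP; rewrite eqn_pmul2r ?odop_gt0 // => /eqP.
  by rewrite !modn_small // => ji; apply/val_inj.
by move=> _ /mapP[j _ ->]; apply: zs; case: (gP j).
Qed.

(** With [h] maximal, join a period [d] to [h * odop q n]: the lcm with some [odop q m] has the form
    [k * odop q m] with [k] admissible and divisible by [h], so [k = h]. *)
Lemma max_coprime_period z : finite_set (p @^-1` [set z]) ->
  exists h n, coprime_period h n /\ forall d, period T d ->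
    exists2 m, (n <= m)%N & (d %| h * odop q m)%N.
Proof.
move=> /finite_seqP[s sE].
have zs x : p x = z -> x \in s.
  by move=> px; have : (p @^-1` [set z]) x by []; rewrite sE.
pose P h := `[< exists n, coprime_period h n >].
have P1 : exists h, P h.
  exists 1%N; apply/asboolP; exists 0%N; split.
    by rewrite /odop big_ord0; exact: period1.
  by move=> m _; exact: coprime1n.
have [|h /asboolP[n gh] hmax] := @ex_maxnP P (size s) P1.
  by move=> h /asboolP[n gh]; exact: coprime_period_bound zs gh.
exists h, n; split=> // d pd.
have pl := period_lcm pd gh.1.
have [m [k [nm lE co]]] := @lcm_odop q _ n pl.1.
have pm : period T (odop q m).
  by split; [exact: odop_gt0 | exists (fun x => odoval (p x) m)].
have gk : coprime_period k m.
  by split=> //; rewrite -lE; exact: period_lcm.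
(* Cancelling [odop q n] leaves [h] dividing [k * r], and [h] is coprime to [r]. *)
have hk : (h %| k)%N.
  have [r e cr] := @odop_coprime q h n m nm gh.2.
  rewrite -(Gauss_dvdl _ cr) -(dvdn_pmul2r (odop_gt0 q n)) -mulnA -e -lE.
  exact: dvdn_trans (dvdn_lcmr _ _) (dvdn_lcml _ _).
have kh : k = h.
  apply/eqP; rewrite eqn_leq (dvdn_leq (coprime_period_gt0 gk) hk) andbT.
  by apply: hmax; apply/asboolP; exists m.
exists m => //; rewrite -kh -lE.
exact: dvdn_trans (dvdn_lcml _ _) (dvdn_lcml _ _).
Unshelve. all: by end_near. Qed.

End Periods.

(** * Topology and uniformity of an odometer *)

Section OdometerTopology.
Variable q : odoseq.

Lemma odometer_continuous (X : topologicalType) (F : X -> odometer q) :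
  (forall n, locally_constant (fun x => odoval (F x) n)) -> continuous F.
Proof.
move=> lF; apply: continuous_comp_initial.
pose K k : topologicalType := discrete_topology (odocyc q k).
apply: (@prod_topology_continuous _ nat K) => n x B /nbhs_singleton Bx.
apply: filterS (lF n x) => y e.
by rewrite -[_ y]/(B (odoval (F y) n)) e.
Qed.

Lemma odometer_hausdorff : hausdorff_space (odometer q).
Proof.
move=> x y clxy; apply: odoval_inj => n.
have [z [<- <-]] := clxy _ _ (odoval_near x n) (odoval_near y n).
by [].
Qed.

Lemma entourage_nbhs_diag (Z : uniformType) (E : set (Z * Z)) (x : Z) :
  entourage E -> nbhs (x, x) E.
Proof.
move=> entE; have entE' := entourage_split_ent entE.
exists ([set a | split_ent E (a, x)], [set b | split_ent E (x, b)]).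
  split; last by apply: filterS (nbhs_entourage x entE') => a /xsectionP.
  apply: filterS (nbhs_entourage x (entourage_inv entE')) => a.
  by move=> /xsectionP.
move=> [a b] [/= ax xb].
exact: entourage_split entE ax xb.
Qed.

(** Otherwise compactness gives a pair agreeing in all coordinates, hence diagonal, outside the
    interior of [E]; but [E] is a neighbourhood of the diagonal. *)
Lemma odometer_entourage (E : set (odometer q * odometer q)) :
  compact [set: odometer q] -> entourage E ->
  exists n, forall x y, odoval x n = odoval y n -> E (x, y).
Proof.
move=> cZ entE; apply: contrapT => nE.
have nE' n : exists w : odometer q * odometer q,
    odoval w.1 n = odoval w.2 n /\ ~ E w.
  apply: contrapT => nw; apply: nE; exists n => x y e.
  by apply: contrapT => nExy; apply: nw; exists (x, y).
pose K n := [set w : odometer q * odometer q | odoval w.1 n = odoval w.2 n] `&`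
  ~` E°.
have [|n|n|n w|[x y] Kxy] := @nested_compact _ K.
- by rewrite -setXTT; exact: compact_setX.
- apply: closedI; last by rewrite closedC; exact: open_interior.
  apply: locally_constant_closed => -[x y].
  exists ([set z | odoval z n = odoval x n], [set z | odoval z n = odoval y n]).
    by split; exact: odoval_near.
  by move=> [a b] [/= -> ->].
- have [w [e nw]] := nE' n; exists w; split=> // Ew; apply: nw.
  exact: interior_subset Ew.
- move=> [e nw]; split=> //; apply/val_inj => /=.
  by rewrite -(odoval_mod w.1 (leqnSn n)) -(odoval_mod w.2 (leqnSn n)) e.
have exy : x = y by apply: odoval_inj => n; have [] := Kxy n.
have [_] := Kxy 0%N; apply; rewrite -exy; exact: entourage_nbhs_diag.
Qed.

Lemma odoval_add (x y z : odometer q) n :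
  odoval x n = odoval y n -> odoval (x + z)%R n = odoval (y + z)%R n.
Proof.
by move=> e; rewrite -[LHS]/(odoval x n + odoval z n)%R e.
Qed.

(** Translations preserve agreement in coordinate [n], whatever the power. *)
Lemma odostep_equicontinuous :
  compact [set: odometer q] -> equicontinuous_system (@odostep q).
Proof.
move=> cZ; split => //; first exact: odometer_hausdorff.
exists (fun x => x - odoone q)%R; split.
- by move=> x; rewrite /odostep addrK.
- by move=> x; rewrite /odostep subrK.
move=> x E entE; have [n nE] := odometer_entourage cZ entE.
apply: filterS (odoval_near x n) => y /esym e i; apply: nE.
case: i => m; elim: m => [|m IH] /=; [exact: e | | |]; exact: odoval_add.
Qed.

End OdometerTopology.

(** * Odometers as factors of a minimal system *)

Section OdometerFactor.
Variables (X : topologicalType) (T : X -> X).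
Hypotheses (cX : compact [set: X]) (hX : hausdorff_space X).
Hypotheses (cT : continuous T) (injT : injective T) (mT : minimal_system T).
Variable q : odoseq.

Lemma odometer_range (F : X -> odometer q) : continuous F ->
  (forall x, F (T x) = odostep (F x)) -> range F = [set: odometer q].
Proof.
move=> cF FT; rewrite eqEsubset; split=> // z _.
have [x0 _] := mT.1.
pose K n := [set x | odoval (F x) n = odoval z n].
have [n|n|n x e|x Kx] := @nested_compact X K cX.
- apply: locally_constant_closed => x.
  have := locally_constant_continuous cF (@odoval_locally_constant q n) x.
  by apply: filterS => y e; rewrite /K /= e.
(* The summand [odop q n] only keeps the subtraction from truncating. *)
- exists (iter (odop q n - odoval (F x0) n + odoval z n) T x0).
  apply/odoval_eqP; rewrite (clock_iter _ _ (clock_odoval n cF FT)).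
  rewrite addnA subnKC ?modnDl //.
  by rewrite ltnW // -[X in (_ < X)%N]odopK.
- apply/val_inj => /=.
  by rewrite -(odoval_mod (F x) (leqnSn n)) -(odoval_mod z (leqnSn n)) e.
by exists x => //; apply: odoval_inj.
Qed.

(** Clocks chosen separately for each [n] need not be compatible. Normalised as [b n] to vanish at
    [x0], they are, by minimality, and form a thread. *)
Lemma odometer_factor : (forall n, period T (odop q n)) ->
  exists F : X -> odometer q, factor_map T (@odostep q) F.
Proof.
move=> pq; have [x0 _] := mT.1.
pose c n := sval (cid (pq n).2).
have cc n : clock T (odop q n) (c n) := svalP (cid (pq n).2).
pose b n x := (c n x + (odop q n - c n x0 %% odop q n))%N.
have b0 n : b n x0 = 0 %[mod odop q n].
  by rewrite /b -modnDml subnKC ?modnn ?mod0n // ltnW // ltn_pmod // odop_gt0.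
have cb n : clock T (odop q n) (b n).
  have [lc ccT] := cc n; split=> x.
    by apply: filterS (lc x) => y e; rewrite /b -modnDml e modnDml.
  by rewrite /b -modnDml ccT modnDml.
have bS n x : b n.+1 x = b n x %[mod odop q n].
  have [_ bT] := cb n; have cb' := clock_dvd (odop_dvdS q n) (cb n.+1).
  have b0' : b n.+1 x0 = 0 %[mod odop q n].
    by rewrite -(modn_dvdm _ (odop_dvdS q n)) b0 !mod0n.
  pose C := [set w | b n.+1 w = b n w %[mod odop q n]].
  apply: (minimal_forward cX hX cT injT mT (C := C) (x0 := x0)).
  - apply: locally_constant_closed => w.
    by apply: filterS2 (cb'.1 w) ((cb n).1 w) => y e e'; rewrite /C /= e e'.
  - by rewrite /C /= b0 b0'.
  - move=> w; rewrite /C /= cb'.2 bT => e.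
    by rewrite -addn1 -modnDml e modnDml addn1.
have vE n x : (inZp (b n x) : odocyc q n) = (b n x %% odop q n)%N :> nat.
  by rewrite /= odopK.
have bth x n : ((inZp (b n.+1 x) : odocyc q n.+1) %% odop q n)%N =
    (inZp (b n x) : odocyc q n).
  by rewrite !vE modn_dvdm ?odop_dvdS.
pose F x := odomk (bth x).
have FE x n : odoval (F x) n = (b n x %% odop q n)%N :> nat by exact: vE.
have cF : continuous F.
  apply: odometer_continuous => n x; apply: filterS ((cb n).1 x) => y e.
  by apply: ord_inj; rewrite !FE.
have FT x : F (T x) = odostep (F x).
  apply: odoval_inj => n; apply/odoval_eqP.
  by rewrite odoval_step !FE modn_mod (cb n).2 -addn1 -modnDml addn1.
by exists F; split=> //; exact: odometer_range.
Qed.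

End OdometerFactor.

(** * Homomorphisms between odometers *)

Section OdometerProjection.
Variables q q' : odoseq.
Hypothesis dvdq : forall m, (odop q m %| odop q' m.+1)%N.

Lemma odoprojP (x : odometer q') m :
  ((inZp (odoval x m.+2) : odocyc q m.+1) %% odop q m)%N =
  (inZp (odoval x m.+1) : odocyc q m).
Proof.
rewrite /= -(odoval_mod x (leqnSn m.+1)); move: (odoval x m.+2 : nat) => k.
by rewrite !odopK !modn_dvdm ?odop_dvdS.
Qed.

(** Coordinate [m] is read off coordinate [m.+1], since level [0] of [q'] is trivial and [h] enters
    only at level [1] of the extension below. *)
Definition odoproj (x : odometer q') : odometer q := odomk (odoprojP x).

Lemma odoprojE x m :
  odoval (odoproj x) m = (odoval x m.+1 %% odop q m)%N :> nat.
Proof.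
rewrite [odoval _ m](_ : _ = inZp (odoval x m.+1)) //=.
by move: (odoval x m.+1 : nat) => k; rewrite odopK.
Qed.

Lemma odoproj_nmod_morphism : nmod_morphism odoproj.
Proof.
split=> [|x y]; apply: odoval_inj => m; apply: ord_inj; rewrite odoprojE.
  by rewrite [odoval 0%R _](_ : _ = 0%R) //= mod0n.
rewrite -[odoval (odoproj x + odoproj y)%R m]/(odoval (odoproj x) m
  + odoval (odoproj y) m)%R.
rewrite -[odoval (x + y)%R _]/(odoval x m.+1 + odoval y m.+1)%R.
by rewrite !odocycD !odoprojE modn_dvdm // modnDm.
Qed.

HB.instance Definition _ :=
  GRing.isNmodMorphism.Build (odometer q') (odometer q) odoproj
    odoproj_nmod_morphism.

Lemma odoproj_continuous : continuous odoproj.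
Proof.
apply: odometer_continuous => m x.
apply: filterS (odoval_near x m.+1) => y e.
by apply: ord_inj; rewrite !odoprojE e.
Qed.

Lemma odoproj_step x : odoproj (odostep x) = odostep (odoproj x).
Proof.
apply: odoval_inj => m; apply/odoval_eqP; rewrite odoval_step !odoprojE.
rewrite modn_mod -(modn_dvdm _ (dvdq m)) odoval_step modn_dvdm //.
by rewrite -addn1 -modnDml addn1.
Qed.

End OdometerProjection.

(** * The extended odometer and the kernel of its projection *)

Section CyclicKernel.
Variables (q : odoseq) (h n : nat).
Hypotheses (h_gt0 : (0 < h)%N) (coh : forall m, (n <= m)%N -> coprime h (q m)).

(** Taking [h * odop q n] as one factor makes the whole kernel visible in coordinate [1]. *)
Definition extq k : nat := if k is j.+1 then q (n + j) else h * odop q n.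

Lemma extq_gt0 k : (0 < extq k)%N.
Proof. by case: k => [|k] /=; rewrite ?muln_gt0 ?h_gt0 ?odop_gt0 ?odoq_gt0. Qed.

Lemma extq_inf N : exists2 k, (N <= k)%N & (1 < extq k)%N.
Proof.
have [k Nk k1] := odoq_inf q (n + N); exists (k - n).+1; first by lia.
by rewrite /= subnKC //; lia.
Qed.

Definition ext_odoseq := OdoSeq extq_gt0 extq_inf.
Local Notation q' := ext_odoseq.

Lemma odop_ext m : odop q' m.+1 = (h * odop q (n + m))%N.
Proof.
elim: m => [|m IH]; first by rewrite /odop big_ord1 addn0.
by rewrite odopS IH addnS odopS mulnA.
Qed.

Lemma odop_dvd_ext m : (odop q m %| odop q' m.+1)%N.
Proof. by rewrite odop_ext dvdn_mull // odop_dvd // leq_addl. Qed.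

Local Notation phi := (odoproj odop_dvd_ext).

Lemma odoproj_ker_dvd w m : phi w = 0%R -> (odop q (n + m) %| odoval w m.+1)%N.
Proof.
move=> w0; rewrite -(odoval_mod w (_ : m < (n + m).+1)%N) ?ltnS ?leq_addl //.
have := odoprojE odop_dvd_ext w (n + m); rewrite w0.
move: (odoval w (n + m).+1 : nat) => k k0.
by rewrite odop_ext /dvdn modn_dvdm ?dvdn_mull // -k0.
Qed.

(** Coordinate [m.+1] is divisible by [odop q (n + m)] and by [h * odop q n], hence by their lcm,
    which is the modulus [h * odop q (n + m)]. *)
Lemma odoproj_ker_eq0 w : phi w = 0%R -> odoval w 1 = 0%R -> w = 0%R.
Proof.
move=> w0 w1; apply: odoval_inj => -[|m]; apply: ord_inj.
  have lt0 (i : odocyc q' 0) : i = 0%N :> nat.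
    apply/eqP; rewrite -leqn0 -ltnS (leq_trans (ltn_ord i)) //.
    by rewrite /odop big_ord0.
  by rewrite !lt0.
have lt : (odoval w m.+1 < h * odop q (n + m))%N.
  by rewrite -odop_ext -[ltnRHS]odopK.
have d1 := odoproj_ker_dvd m w0.
have d2 : (h * odop q n %| odoval w m.+1)%N.
  have := odoval_mod w (isT : 1 <= m.+1)%N; rewrite w1.
  by move: (odoval w m.+1 : nat) => k; rewrite odop_ext addn0 => /eqP.
have [r e cr] := odop_coprime (leq_addr m n) coh.
have : (h * odop q (n + m) %| odoval w m.+1)%N.
  move/dvdnP: d2 => [a ea]; move: d1; rewrite ea e !mulnA.
  rewrite !dvdn_pmul2r ?odop_gt0 // Gauss_dvdl ?(coprime_sym r) // => ra.
  by rewrite mulnC dvdn_pmul2r.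
by rewrite /dvdn modn_small // => /eqP ->.
Qed.

Lemma odovalMn (u : odometer q') a :
  odoval (u *+ a)%R 1 = (odoval u 1 * a)%N %% (h * odop q n) :> nat.
Proof.
elim: a => [|a IH]; first by rewrite mulr0n muln0 mod0n.
rewrite mulrSr -[odoval _ 1]/(odoval (u *+ a)%R 1 + odoval u 1)%R odocycD IH.
move: (odoval u 1 : nat) => k.
by rewrite odop_ext addn0 modnDml mulnSr.
Qed.

(** Kernel elements are determined by coordinate [1], a multiple of [odop q n]; the multiples of [u]
    realise all [h] of these. *)
Lemma odoproj_cyclic_kernel u : phi u = 0%R ->
  odoval u 1 = odop q n %[mod h * odop q n] ->
  exists (k : nat) (i : {additive 'I_k.+1 -> odometer q'}),
    injective i /\ range i = [set z | phi z = 0%R].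
Proof.
move=> u0 u1.
have uE a : odoval (u *+ a)%R 1 = (a * odop q n)%N %% (h * odop q n) :> nat.
  by rewrite odovalMn -modnMml u1 modnMml mulnC.
have ua0 a : phi (u *+ a)%R = 0%R by rewrite raddfMn /= u0 mul0rn.
have uh : (u *+ h = 0)%R.
  by apply: odoproj_ker_eq0 => //; apply: ord_inj; rewrite uE modnn.
exists h.-1.
pose i (a : 'I_h.-1.+1) := (u *+ a)%R.
have imorph : nmod_morphism i.
  split=> [|a b]; first by rewrite /i mulr0n.
  rewrite /i /= -mulrnDr {2}(divn_eq (a + b) h) mulrnDr mulnC mulrnA uh mul0rn.
  by rewrite add0r; move: (a + b)%N => s; rewrite prednK.
pose mi := GRing.isNmodMorphism.Build _ _ i imorph.
pose ia : {additive 'I_h.-1.+1 -> odometer q'} := HB.pack i mi.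
have lth (a : 'I_h.-1.+1) : (a < h)%N by rewrite -[ltnRHS](prednK h_gt0).
exists ia; split=> [a b /= e|].
  apply: ord_inj; have : odoval (i a) 1 = odoval (i b) 1 :> nat.
    by rewrite [i a]e.
  rewrite !uE -!muln_modl => /eqP; rewrite eqn_pmul2r ?odop_gt0 //.
  rewrite !modn_small //.
  by move=> /eqP.
rewrite eqEsubset; split=> [_ [a _ <-]|w w0]; first exact: ua0.
have /dvdnP[a ea] := odoproj_ker_dvd 0 w0; rewrite addn0 in ea.
have ah : (a < h.-1.+1)%N.
  rewrite prednK // -(ltn_pmul2r (odop_gt0 q n)) -ea.
  by rewrite -[X in (_ * odop _ X)%N](addn0 n) -odop_ext -[ltnRHS]odopK.
exists (Ordinal ah) => //; apply/esym/subr0_eq; apply: odoproj_ker_eq0.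
  by rewrite raddfB /= w0 ua0 subrr.
rewrite -[LHS]/(odoval w 1 - odoval (u *+ a) 1)%R; apply/eqP; rewrite subr_eq0.
apply/eqP; apply: ord_inj; rewrite uE -ea modn_small //.
by rewrite -[X in (_ * odop _ X)%N](addn0 n) -odop_ext -[ltnRHS]odopK.
Qed.

End CyclicKernel.

(** * Equicontinuous factors in the presence of a finite fibre *)

Lemma filter_all_in (Z : Type) (I : eqType) (F : set_system Z) (s : seq I)
    (f : I -> set Z) : Filter F ->
  (forall i, i \in s -> F (f i)) -> F [set w | forall i, i \in s -> f i w].
Proof.
move=> FF; elim: s => [|i s IH] Fs; first by apply: filterS filterT.
have Fi := Fs i (mem_head i s).
have {IH}Fs' := IH (fun j js => Fs j (@mem_behead _ (i :: s) j js)).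
apply: filterS2 Fi Fs' => w fi fs j; rewrite inE => /orP[/eqP -> //|].
exact: fs.
Qed.

Lemma hausdorff_entourage_eq (Y : uniformType) (a b : Y) : hausdorff_space Y ->
  (forall E, entourage E -> E (a, b)) -> a = b.
Proof.
move=> hY ab; apply: hY => A B; rewrite -nbhs_entourageE => -[E entE EA] nB.
exists b; split; last by move/nbhsP : nB => /nbhs_singleton.
by apply: EA; apply/xsectionP; exact: ab.
Qed.

Section EquicontinuousFactor.
Variables (X : topologicalType) (T : X -> X).
Hypotheses (cX : compact [set: X]) (hX : hausdorff_space X).
Hypotheses (cT : continuous T) (injT : injective T) (mT : minimal_system T).
Variables (q : odoseq) (p : X -> odometer q).
Hypothesis fp : factor_map T (@odostep q) p.
Variable z : odometer q.
Hypothesis fin_z : finite_set (p @^-1` [set z]).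
Variables (Y : uniformType) (R : Y -> Y) (g : X -> Y).
Hypotheses (eqR : equicontinuous_system R) (fg : factor_map T R g).

(** A finite intersection: each pair of distinct images of fibre points is omitted by some
    entourage, as [Y] is Hausdorff. *)
Lemma fibre_separating :
  entourage [set w : Y * Y | forall a b, p a = z -> p b = z ->
    w = (g a, g b) -> g a = g b].
Proof.
have /finite_seqP[s sE] := fin_z.
have zs x : p x = z -> x \in s.
  by move=> px; have : (p @^-1` [set z]) x by []; rewrite sE.
suff H : entourage [set w : Y * Y | forall a, a \in s ->
    forall b, b \in s -> w = (g a, g b) -> g a = g b].
  by apply: filterS H => w H a b /zs as_ /zs bs; exact: H.
apply: filter_all_in => a _; apply: filter_all_in => b _.
have [e|ne] := pselect (g a = g b); first by apply: filterS filterT.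
have [E entE nE] : exists2 E, entourage E & ~ E (g a, g b).
  apply: contrapT => nE; apply/ne/hausdorff_entourage_eq; first by case: eqR.
  by move=> E entE; apply: contrapT => nEab; apply: nE; exists E.
by apply: filterS entE => w Ew e; rewrite e in Ew.
Qed.

(* Points close under all powers of [R] to finitely many fibre points that are
   far apart: closeness is then an equivalence relation with clopen classes over
   a small cylinder around [z], and one class is a block. *)
Lemma equicontinuous_clock (E : set (Y * Y)) : entourage E ->
  exists d c, [/\ (0 < d)%N, clock T d c &
    forall x y, c x = c y %[mod d] -> E (g x, g y)].
Proof.
move=> entE; have [_ _ [R' [RK R'K eqc]]] := eqR.
have [cg _ gT] := fg; have [cp rp pT] := fp.
have /(_ _) entE' := filterI entE fibre_separating; set E' := _ `&` _ in entE'.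
(* Splitting twice allows chains of four links; the longest one occurs in the block property of
   [U]. *)
pose D := split_ent (split_ent E').
have entD1 : entourage (split_ent E') := entourage_split_ent entE'.
have entD : entourage D := entourage_split_ent entD1.
pose V a b := forall i, D (ziter R R' i a, ziter R R' i b) /\
                        D (ziter R R' i b, ziter R R' i a).
have Vsym a b : V a b -> V b a by move=> ab i; split; case: (ab i).
have Vrefl a : V a a by move=> i; split; exact: entourage_refl.
have V4 a b c d e i : V a b -> V b c -> V c d -> V d e ->
    E' (ziter R R' i a, ziter R R' i e).
  move=> /(_ i)[ab _] /(_ i)[bc _] /(_ i)[cd _] /(_ i)[de _].
  apply: (entourage_split (ziter R R' i c) entE').
    exact: entourage_split entD1 ab bc.
  exact: entourage_split entD1 cd de.
have Vnear a : \forall b \near a, V a b.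
  have entDI : entourage (D `&` [set w | D (w.2, w.1)]).
    exact: filterI entD (entourage_inv entD).
  by apply: filterS (eqc a _ entDI) => b ab i; split; case: (ab i).
have VR a b : V a b -> V (R a) (R b).
  move=> ab; case=> [m|[|m]].
  - by have := ab (Posz m.+1); rewrite /ziter !iterSr.
  - by have := ab 0%Z; rewrite /= !RK.
  - by have := ab (Negz m); rewrite /ziter !(iterSr m.+1) !RK.
have Viter m a b : V a b -> V (iter m R a) (iter m R b).
  by move=> ab; elim: m => [//|m IH]; exact: VR.
have gTi m x : g (iter m T x) = iter m R (g x).
  by elim: m => [//|m IH] /=; rewrite gT IH.
pose W := [set b | exists2 a, p a = z & V (g a) (g b)].
(* By compactness: the cylinders around [z] shrink to the fibre, which lies in the interior of
   [W]. *)
have [N QW] : exists N, forall b, odoval (p b) N = odoval z N -> W b.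
  apply: contrapT => nN.
  have nQ N : exists b, odoval (p b) N = odoval z N /\ ~ W b.
    apply: contrapT => nb; apply: nN; exists N => b e.
    by apply: contrapT => nW; apply: nb; exists b.
  pose K m := [set b | odoval (p b) m = odoval z m] `&` ~` W°.
  have [m|m|m b|x Kx] := @nested_compact X K cX.
  - apply: closedI; last by rewrite closedC; exact: open_interior.
    apply: locally_constant_closed => x.
    have := locally_constant_continuous cp (@odoval_locally_constant q m) x.
    by apply: filterS => y /= ->.
  - have [b [e nW]] := nQ m; exists b; split=> // Wb; apply: nW.
    exact: interior_subset Wb.
  - move=> [e nW]; split=> //; apply: ord_inj.
    by rewrite -(odoval_mod (p b) (leqnSn m)) -(odoval_mod z (leqnSn m)) e.
  have px : p x = z by apply: odoval_inj => m; have [] := Kx m.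
  have [_] := Kx 0%N; apply.
  have : \forall b \near x, V (g x) (g b) := cg x _ (Vnear (g x)).
  by apply: filterS => b Vb; exists x.
have [x1 _ px1] : range p z by rewrite rp.
pose U := [set b | odoval (p b) N = odoval z N /\ V (g x1) (g b)].
have sep a : p a = z -> E' (ziter R R' 0%Z (g a), ziter R R' 0%Z (g x1)) ->
  g a = g x1 by move=> pa [_]; exact.
(* A point of the cylinder is close to some fibre point [a]; a chain from [a] to [x1] forces
   [g a = g x1] by separation. This replaces transitivity of [V]. *)
have lU : locally_constant U.
  move=> x.
  have np := locally_constant_continuous cp (@odoval_locally_constant q N) x.
  have nV : \forall b \near x, V (g x) (g b) := cg x _ (Vnear (g x)).
  apply: filterS2 np nV => y ey Vxy.
  apply/propext; rewrite /U /= ey; split=> -[e V1]; split=> //.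
    have [a pa Va] := QW x e.
    rewrite -(sep a pa) //.
    exact: V4 Va Vxy (Vsym _ _ V1) (Vrefl _).
  have [a pa Va] := QW y (etrans ey e).
  rewrite -(sep a pa) //.
  exact: V4 Va (Vsym _ _ Vxy) (Vsym _ _ V1) (Vrefl _).
have Ux1 : U x1 by split; rewrite ?px1.
have [|d [c [d0 cc _ cU]]] := block_clock cX hX cT injT mT lU Ux1.
  move=> m a b [ea Va] [eb Vb] [em Vm].
  have em' : odoval (p (iter m T b)) N = odoval z N.
    rewrite -em; apply/odoval_eqP.
    by rewrite !(clock_iter _ _ (clock_odoval N cp pT)) ea eb.
  (* The chain runs through the images of [a'], [T ^ m b], [T ^ m x1], [T ^ m a] and [x1]. *)
  split=> //; have [a' pa' Va'] := QW _ em'.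
  rewrite -(sep a' pa') //; rewrite gTi in Vm; rewrite gTi in Va'.
  exact: V4 Va' (Vsym _ _ (Viter m _ _ Vb)) (Viter m _ _ Va) (Vsym _ _ Vm).
exists d, c; split=> // x y /cU[t [[_ Vx] [_ Vy]]].
(* Closeness at time [t] is pulled back to time [0] by the power [- t], which [V] also controls;
   [Negz t'] is [- t'.+1]. *)
have back : exists i, forall a, ziter R R' i (iter t R a) = a.
  exists (if t is t'.+1 then Negz t' else Posz 0) => a.
  have H : iter t R' (iter t R a) = a.
    elim: t a {Vx Vy} => [//|t IH] a.
    by rewrite iterSr iterS RK IH.
  by case: t H {Vx Vy}.
have [i iK] := back.
rewrite !gTi in Vx Vy.
by have [] := V4 _ _ _ _ _ i (Vsym _ _ Vx) Vy (Vrefl _) (Vrefl _); rewrite !iK.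
Qed.

(** No clock separates points with the same image under [f], so their images under [g] lie in every
    entourage and agree. The induced map is continuous because [f] is closed. *)
Lemma universal_factor (Z : topologicalType) (S : Z -> Z) (f : X -> Z) :
  hausdorff_space Z -> factor_map T S f ->
  (forall x y, f x = f y -> forall d c, (0 < d)%N -> clock T d c ->
    c x = c y %[mod d]) ->
  exists2 k : Z -> Y, factor_map S R k & forall x, g x = k (f x).
Proof.
move=> hZ [cf rf fT] ff; have [cg rg gT] := fg.
have fgE x y : f x = f y -> g x = g y.
  move=> /ff fxy; apply: hausdorff_entourage_eq; first by case: eqR.
  move=> E entE; have [d [c [d0 cc cE]]] := equicontinuous_clock entE.
  by apply: cE; exact: fxy.
have pre w : exists x, f x = w.
  have [x _ <-] : range f w by rewrite rf.
  by exists x.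
pose k w := g (sval (cid (pre w))).
have kf x : k (f x) = g x by apply: fgE; exact: svalP (cid (pre (f x))).
exists k => //; split.
- apply/continuous_closedP => C clC.
  have -> : k @^-1` C = f @` (g @^-1` C).
    rewrite eqEsubset; split=> [w|_ [x gx <-]]; last by rewrite /= kf.
    by have [x <-] := pre w; rewrite /= kf => gx; exists x.
  apply: compact_closed => //; apply: continuous_compact.
    exact: continuous_subspaceT.
  apply: subclosed_compact cX _ => //.
  by move/continuous_closedP : cg; apply.
- rewrite eqEsubset; split=> // y _.
  have [x _ <-] : range g y by rewrite rg.
  by exists (f x).
- by move=> w; have [x <-] := pre w; rewrite -fT !kf.
Qed.

End EquicontinuousFactor.

(** * Compactness, separation and continuity for shifts *)

Section Shift.
Variables (A : finType) (X : set (full_shift A)) (hX : is_shift X).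

Lemma full_shift_compact : compact [set: full_shift A].
Proof.
have cA (i : int) : compact [set: discrete_topology A].
  by apply: finite_compact; exact: (@finite_finset A).
have := @tychonoff int (fun=> discrete_topology A) (fun=> setT) cA.
by congr compact; rewrite eqEsubset; split.
Qed.

Lemma full_shift_hausdorff : hausdorff_space (full_shift A).
Proof.
apply: (@hausdorff_product int (fun=> discrete_topology A)) => i.
exact: (@discrete_hausdorff (discrete_topology A)).
Qed.

Lemma set_val_continuous (Y : topologicalType) (C : set Y) :
  continuous (\val : C -> Y).
Proof. exact: initial_continuous. Qed.

Lemma set_type_compact (Y : topologicalType) (C : set Y) :
  compact [set: Y] -> closed C -> compact [set: C].
Proof.
move=> cY clC F FF _.
have cC := subclosed_compact clC cY (@subsetT _ C).
have GC : F (\val @^-1` C) by apply: filterS filterT => x _; exact: set_valP.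
have [y [Cy cly]] := cC (\val @ F) _ GC.
have yC : y \in C by exact/mem_set.
exists (exist _ y yC); split=> // B N FB.
rewrite nbhsE => -[V [[U oU <-] Uy] VN].
have GB : F (\val @^-1` (\val @` B)) by apply: filterS FB => b Bb; exists b.
have [_ [[b Bb <-] Ub]] := cly _ _ GB (open_nbhs_nbhs (conj oU Uy)).
by exists b; split=> //; exact: VN.
Qed.

Lemma set_type_hausdorff (Y : topologicalType) (C : set Y) :
  hausdorff_space Y -> hausdorff_space C.
Proof.
move=> hY x y clxy; apply/val_inj/hY => U V Ux Vy.
have [w [Uw Vw]] := clxy _ _ (@set_val_continuous Y C x U Ux)
  (@set_val_continuous Y C y V Vy).
by exists (\val w).
Qed.

Lemma shift_on_inj : injective (shift_on hX).
Proof.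
move=> x y /(congr1 \val) /= e; apply: val_inj; apply: funext => i.
have := congr1 (fun f : full_shift A => f (i - 1)%R) e.
by rewrite /Defs.shift subrK.
Qed.

Lemma shift_continuous : continuous (@Defs.shift A).
Proof.
apply: (@prod_topology_continuous _ int (fun=> discrete_topology A)) => i.
exact: (@proj_continuous int (fun=> discrete_topology A) (i + 1)%R).
Qed.

Lemma shift_on_continuous : continuous (shift_on hX).
Proof.
apply: continuous_comp_initial => x.
apply: (@continuous_comp _ _ _ (\val : X -> full_shift A) (@Defs.shift A)).
  exact: set_val_continuous.
exact: shift_continuous.
Qed.

End Shift.

(** * The extended odometer as maximal equicontinuous factor *)

Theorem theorem16 (A : finType) (X : set (full_shift A)) (hX : is_shift X)
    (q : odoseq) (p : X -> odometer q) :
  minimal_system (shift_on hX) ->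
  factor_map (shift_on hX) (@odostep q) p ->
  (exists z : odometer q, finite_set (p @^-1` [set z])) ->
  exists (q' : odoseq) (f : X -> odometer q'),
    max_equicontinuous_factor (shift_on hX) (@odostep q') f /\
    exists phi : {additive odometer q' -> odometer q},
      finite_cyclic_extension phi.
Proof.
move=> mT fp [z fin_z].
have cX : compact [set: X].
  by apply: set_type_compact (@full_shift_compact A) hX.1.
have hausX : hausdorff_space X.
  by exact: set_type_hausdorff (@full_shift_hausdorff A).
have cT := @shift_on_continuous A X hX; have injT := @shift_on_inj A X hX.
have [h [n [gh hmax]]] := max_coprime_period cX hausX cT injT mT fp fin_z.
have h0 := coprime_period_gt0 gh; have coh := gh.2.
pose q' := ext_odoseq q n h0.
have pq' k : period (shift_on hX) (odop q' k).
  case: k => [|k]; last first.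
    rewrite odop_ext.
    by case: (coprime_period_le cX hausX cT injT mT fp (leq_addr k n) gh).
  by rewrite /odop big_ord0; exact: period1.
have [f ff] := odometer_factor cX hausX cT injT mT pq'.
have [cf rf fT] := ff; have [ctp rp pT] := fp.
pose phi := odoproj (odop_dvd_ext q n h0).
have cphif : continuous (fun x => phi (f x)).
  by move=> w; apply: continuous_comp; [exact: cf | exact: odoproj_continuous].
have phifT w : phi (f (shift_on hX w)) = odostep (phi (f w)).
  by rewrite fT [phi _]odoproj_step.
(* The maps [phi \o f] and [p] may differ by a translation, but they have the same fibres by
   uniqueness of clocks. *)
have phif x y : p x = p y -> phi (f x) = phi (f y).
  move=> pxy; apply: odoval_inj => m; apply/odoval_eqP.
  apply: (clock_unique cX hausX cT injT mT (clock_odoval m ctp pT)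
    (clock_odoval m cphif phifT)).
  by rewrite pxy.
exists q', f; split.
  split=> //.
    apply: odostep_equicontinuous; rewrite -rf; apply: continuous_compact cX.
    exact: continuous_subspaceT.
  move=> Y R g eqR fg.
  apply: (universal_factor cX hausX cT injT mT fp fin_z eqR fg _ ff).
    exact: odometer_hausdorff.
  (* Every period divides some [h * odop q m], the partial product of [q'] at [(m - n).+1], so its
     clock is determined by that coordinate of [f]. *)
  move=> x y fxy d c d0 cc.
  have pd : period (shift_on hX) d by split=> //; exists c.
  have [m nm dm] := hmax d pd.
  have cm := clock_odoval (m - n).+1 cf fT.
  have dm' : (d %| odop q' (m - n).+1)%N by rewrite odop_ext subnKC.
  apply: (clock_unique cX hausX cT injT mT (clock_dvd dm' cm) cc).
  by rewrite fxy.
exists phi; split.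
- exact: odoproj_continuous.
- rewrite eqEsubset; split=> // w _.
  have [x _ <-] : range (fun x => phi (f x)) w.
    by rewrite (odometer_range cX mT cphif phifT).
  by exists (f x).
have [x0 _] := mT.1.
pose c x := nat_of_ord (odoval (f x) 1).
have e1 : odop q' 1 = (h * odop q n)%N by rewrite odop_ext addn0.
have c1 : clock (shift_on hX) (h * odop q n) c.
  by rewrite -e1; exact: clock_odoval.
(* With [j = 1], two points of one fibre of [p] have clocks differing by [odop q n]; the difference
   of their images under [f] generates the kernel. *)
have [x px cx] := coprime_period_fibre cX fp x0 1 gh c1.
apply: (odoproj_cyclic_kernel coh (u := f x - f x0)%R).
  by rewrite raddfB /= [odoproj _ _](phif _ _ px) subrr.
have := congr1 (@nat_of_ord _) (subrK (odoval (f x0) 1) (odoval (f x) 1)).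
rewrite odocycD -[(_ - _)%R]/(odoval (f x - f x0)%R 1).
rewrite -/(c x) -/(c x0); move: (odoval _ 1 : nat) (c x) (c x0) cx => a b b0.
rewrite e1 mul1n => bE e; move: bE; rewrite -e modn_mod addnC => /eqP.
by rewrite eqn_modDl => /eqP.
Unshelve. all: by end_near. Qed.
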